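(* Let $I\subset\mathbb{R}$ be a closed interval and $f,g:I\to I$. Suppose $f$ is Lipschitz continuous, i.e. there is $M<\infty$ such that $|f(x)-f(y)|\le M|x-y|$ for all $x,y\in I$, and $g$ is contractive, i.e. there is $c<1$ such that $|g(x)-g(y)|\le c|x-y|$ for all $x,y\in I$. Suppose that $cM\le 1$, and let $r$ be the greatest positive integer for which $cM^r\le 1$. If the probability $p\in[0,1]$ of choosing $f$ at each step satisfies $p<\frac{r}{1+r}$, then $\mu(f,g,p)=0$.
   Context: It is part of the hypothesis that a greatest positive integer $r$ with $cM^r\le1$ exists. $I$ is a closed bounded interval of length $|I|>0$. For maps $f,g:I\to I$ and $p\in[0,1]$, consider the random dynamical system in which at each step, independently, $f$ is applied with probability $p$ and $g$ with probability $1-p$. Formally, $\Omega=\{f,g\}^{\infty}$ carries the product probability measure $P$ under which the coordinates $\omega_1,\omega_2,\ldots$ are independent with $P(\omega_i=f)=p$, $P(\omega_i=g)=1-p$ ($f$ and $g$ being treated as two distinct symbols). For $x\in I$ the trajectory is $x_0=x$, $x_n(\omega)=\omega_n\circ\omega_{n-1}\circ\cdots\circ\omega_1(x)$. For two starting points $x,y\in I$ the trajectories $x_n$ and $y_n$ are driven by the same $\omega$. Define, for $n\ge 1$ and $t\in\mathbb{R}$, $$F_{xy}^{(n)}(t)=\frac1n\sum_{i=0}^{n-1}P(|x_i-y_i|<t),\quad F_{xy}(t)=\liminf_{n\to\infty}F_{xy}^{(n)}(t),\quad F_{xy}^\star(t)=\limsup_{n\to\infty}F_{xy}^{(n)}(t),$$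 and the measure of (distributional) chaos $$\mu(f,g,p)=\sup_{x,y\in I}\frac1{|I|}\int_0^{|I|}\bigl(F_{xy}^\star(t)-F_{xy}(t)\bigr)\,\mathrm{d}t .$$ *)

(* Defs.v *)
From HB Require Import structures.
From mathcomp Require Import all_boot all_order all_algebra.
From mathcomp Require Import all_classical all_reals all_analysis.

Set Implicit Arguments.
Unset Strict Implicit.
Unset Printing Implicit Defensive.

Import Order.TTheory GRing.Theory Num.Theory.
Import numFieldNormedType.Exports.

Local Open Scope classical_set_scope.
Local Open Scope ring_scope.

(* The two symbols of the alphabet {f, g} are true (for f) and false (for g);
   they stay distinct even when f and g are equal as maps. The i-th coordinate
   of w is the symbol drawn at step i.+1. *)
Definition coordinate_sets : set (set (nat -> bool)) :=
  [set A | exists (i : nat) (B : set bool), A = [set w | B (w i)]].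

Notation symbol_space := (g_sigma_algebraType coordinate_sets).

(* P is the product measure on {f, g}^oo that gives f the weight p: the
   coordinates have the Bernoulli law of parameter p and are mutually
   independent. *)
Definition bernoulli_product (R : realType) (p : R)
    (P : probability symbol_space R) : Prop :=
  (forall i : nat, P [set w | w i = true] = p%:E
                /\ P [set w | w i = false] = (1 - p)%:E)
  /\
  (forall (J : seq nat) (B : nat -> set bool), uniq J ->
     P [set w | forall i, i \in J -> B i (w i)] =
     (\prod_(i <- J) P [set w | B i (w i)])%E).

Section DistributionalChaos.
Variable R : realType.

Fixpoint trajectory (f g : R -> R) (w : nat -> bool) (x : R) (n : nat) : R :=
  if n is m.+1
  then (if w m then f else g) (trajectory f g w x m)
  else x.

Variables (f g : R -> R) (P : probability symbol_space R).

(* Only n >= 1 is meaningful; the value at n = 0 is the empty sum 0. *)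
Definition Fn (x y : R) (n : nat) (t : R) : \bar R :=
  ((n%:R^-1)%:E * \sum_(0 <= i < n)
     P [set w | (`|trajectory f g w x i - trajectory f g w y i| < t)%R])%E.

Definition Flow (x y t : R) : \bar R := limn_einf (fun n => Fn x y n t).

Definition Fup (x y t : R) : \bar R := limn_esup (fun n => Fn x y n t).

(* The interval is I = [a, b], of length b - a. *)
Definition chaos_measure (a b : R) : \bar R :=
  ereal_sup [set z | exists x y : R, [/\ x \in `[a, b], y \in `[a, b] &
    z = (((b - a)^-1)%:E *
         \int[lebesgue_measure]_(t in `[0%R, (b - a)%R])
           (Fup x y t - Flow x y t))%E]].

End DistributionalChaos.

(* Main.v *)
(* Since [r] is greatest, [M > 1], and [c <= M^-r]. Hence [log_M |x_n - y_n|] is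
   dominated by a random walk with steps [1] (probability [p]) and [-r]
   (probability [1 - p]), whose drift [p - r (1 - p)] is negative. A Chernoff
   bound makes [P(|x_n - y_n| >= t)] decay exponentially for every [t > 0], so
   the Cesaro means converge and [F* = F] everywhere. *)
Require Import Defs.
From mathcomp Require Import all_boot all_order all_algebra.
From mathcomp Require Import all_classical all_reals all_analysis.
From mathcomp Require Import ring lra zify.

Import Order.TTheory GRing.Theory Num.Theory.
Import numFieldNormedType.Exports.

Local Open Scope classical_set_scope.
Local Open Scope ring_scope.

(** * Growth of powers and the choice of the tilt *)

Lemma bernoulli_ineq {R : realFieldType} (e : R) (n : nat) :
  0 <= e -> 1 + n%:R * e <= (1 + e) ^+ n.
Proof.
move=> e0; elim: n => [|n IHn]; first by rewrite mul0r addr0 expr0.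
have n0 : 0 <= n%:R :> R by [].
rewrite exprS -natr1; apply: le_trans (ler_wpM2l _ IHn); nra.
Qed.

Lemma expr_unbounded {R : archiRealFieldType} (x y : R) :
  1 < x -> exists n : nat, y <= x ^+ n.
Proof.
move=> x1; have e0 : 0 < x - 1 by rewrite subr_gt0.
have := archi_boundP (normr_ge0 (y / (x - 1))).
set n := Num.bound _ => yn; exists n.
have := bernoulli_ineq (x - 1) n (ltW e0); rewrite (addrC 1 (x - 1)) subrK.
apply: le_trans; rewrite ler_wpDl// -ler_pdivrMr//.
exact: le_trans (ler_norm _) (ltW yn).
Qed.

(* The tilting parameter of the Chernoff bound: at [t = 1] both sides agree,
   and the drift condition says that the right side grows faster. *)
Lemma negative_drift_tilt {R : realFieldType} (p : R) (r : nat) :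
  (0 < r)%N -> 0 <= p <= 1 -> p < r%:R / (1 + r%:R) ->
  exists2 t : R, 1 < t & p * t ^+ r.+1 + (1 - p) < t ^+ r.
Proof.
move=> r0 /andP[p0 p1]; have rR : 0 < r%:R :> R by rewrite ltr0n.
rewrite ltr_pdivlMr ?addr_gt0// => pr.
(* Put [d = r - p (1 + r) > 0]. By Bernoulli's inequality it suffices that
   [(1 + r e) (1 - p (1 + e))] exceeds [1 - p]. The excess is [e (d - r p e)], and [e = d / (2 r)]
   makes [r p e = p d / 2 < d]. *)
pose e : R := (r%:R - p * (1 + r%:R)) / (2 * r%:R).
have e0 : 0 < e by rewrite divr_gt0 ?mulr_gt0// subr_gt0.
have re : r%:R * e * 2 = r%:R - p * (1 + r%:R) by rewrite /e; field; lra.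
exists (1 + e); first by rewrite ltrDl.
have := bernoulli_ineq e r (ltW e0).
set T := (1 + e) ^+ r => rT; rewrite exprS -/T.
have : 1 - p < (1 + r%:R * e) * (1 - p * (1 + e)) by nra.
nra.
Qed.

(** * Head counts and events that depend on finitely many coordinates *)

Definition nb_heads (w : nat -> bool) (n : nat) : nat :=
  (\sum_(0 <= i < n) w i)%N.

Lemma nb_headsS w n : nb_heads w n.+1 = (nb_heads w n + w n)%N.
Proof. by rewrite /nb_heads big_nat_recr. Qed.

Lemma eq_nb_heads w w' n : (forall i, (i < n)%N -> w i = w' i) ->
  nb_heads w n = nb_heads w' n.
Proof. by move=> ww'; apply: eq_big_nat => i /ww' ->. Qed.

Lemma eq_trajectory {R : realType} (f g : R -> R) w w' x n :
  (forall i, (i < n)%N -> w i = w' i) ->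
  trajectory f g w x n = trajectory f g w' x n.
Proof.
elim: n => //= n IHn ww'; rewrite ww'// IHn// => i /ltnW; exact: ww'.
Qed.

Lemma measurable_coordinate (i : nat) (B : set bool) :
  measurable ([set w | B (w i)] : set symbol_space).
Proof. by apply: sub_sigma_algebra; exists i, B. Qed.

(** Induction on the length of the prefix: [A] is split by the value of its last coordinate, and
    freezing that coordinate leaves a set that depends on a shorter prefix. With no coordinate left,
    [A] is empty or the whole space. *)
Lemma measurable_prefix (n : nat) (A : set symbol_space) :
  (forall w w' : nat -> bool, (forall i, (i < n)%N -> w i = w' i) ->
    A w -> A w') ->
  measurable A.
Proof.
elim: n A => [|n IHn] A hA.
  have [->|/set0P[w0 Aw0]] := eqVneq A set0; first exact: measurable0.
  suff -> : A = setT by exact: measurableT.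
  by apply/seteqP; split=> // w _; apply: hA Aw0.
pose upd (w : nat -> bool) b i := if i == n then b else w i.
have slice b : measurable ([set w | A (upd w b)] : set symbol_space).
  apply: IHn => w w' ww'; apply: hA => i; rewrite ltnS leq_eqVlt /upd.
  by case: eqVneq => //= _; apply: ww'.
have -> : A = ([set w | [set true] (w n)] `&` [set w | A (upd w true)]) `|`
              ([set w | [set false] (w n)] `&` [set w | A (upd w false)]).
  have updK w : upd w (w n) = w.
    by apply/funext => i; rewrite /upd; case: eqVneq => // ->.
  apply/seteqP; split=> w /=.
    by rewrite -{1}(updK w); case: (w n) => Aw; [left|right].
  by move=> [] [wn]; rewrite -wn updK.
by apply: measurableU; apply: measurableI => //; exact: measurable_coordinate.
Qed.

Definition cylinder (J : seq nat) (B : nat -> set bool) : set symbol_space :=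
  [set w | forall i, i \in J -> B i (w i)].

Lemma measurable_cylinder J B : measurable (cylinder J B).
Proof.
apply: (@measurable_prefix (\max_(i <- J) i).+1) => w w' ww' Bw i iJ.
by rewrite -ww' ?ltnS ?leq_bigmax_seq//; exact: Bw.
Qed.

Lemma measurable_nb_heads_ge s n m :
  measurable ([set w | (m <= s * nb_heads w n)%N] : set symbol_space).
Proof.
by apply: (@measurable_prefix n) => w w' /eq_nb_heads /= ->.
Qed.

Definition fix_coordinate (n : nat) (b : bool) (B : nat -> set bool) i :=
  if i == n then [set b] else B i.

Lemma cylinder_fix_coordinate J B n b : n \notin J ->
  cylinder (n :: J) (fix_coordinate n b B) =
  [set w | w n = b] `&` cylinder J B.
Proof.
move=> nJ; rewrite /cylinder /fix_coordinate; apply/seteqP; split=> w /=.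
  move=> Bw; split; first by have := Bw n; rewrite eqxx mem_head; apply.
  move=> i iJ; have := Bw i; rewrite in_cons iJ orbT.
  by case: eqVneq => [ni|_]; [rewrite -ni iJ in nJ | apply].
by move=> [wn Bw] i; rewrite in_cons; case: eqVneq => [->//|_] /=; apply: Bw.
Qed.

(** * Chernoff bound for the number of heads *)

Section BernoulliProduct.
Context {R : realType} (p : R) (P : probability symbol_space R).
Hypotheses (hp0 : 0 <= p) (hp1 : p <= 1) (hP : bernoulli_product p P).

Lemma probability_fix_coordinate J B n b : uniq (n :: J) ->
  P (cylinder (n :: J) (fix_coordinate n b B)) =
  ((if b then p else 1 - p)%:E * P (cylinder J B))%E.
Proof.
move=> /[dup] unJ /= /andP[nJ uJ].
have [hmarg hind] := hP; rewrite /cylinder !hind// big_cons.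
congr (_ * _)%E.
  rewrite /fix_coordinate eqxx; have [h1 h0] := hmarg n.
  by case: b => /=.
apply: eq_big_seq => i iJ; rewrite /fix_coordinate.
by case: eqVneq => // ni; rewrite -ni iJ in nJ.
Qed.

(* Chernoff bound. The cylinder supported beyond [n] is what makes the
   induction on the last coordinate go through without conditioning. *)
Lemma nb_heads_chernoff_cylinder (s : nat) (t : R) (n m : nat) J B :
  1 <= t -> uniq J -> (forall i, i \in J -> (n <= i)%N) ->
  (P ([set w | (m <= s * nb_heads w n)%N] `&` cylinder J B) <=
   ((p * t ^+ s + (1 - p)) ^+ n / t ^+ m)%:E * P (cylinder J B))%E.
Proof.
move=> t1; have t0 : 0 < t by exact: lt_le_trans t1.
(* Without any toss the count is 0: for [m = 0] the factor is 1, and for [m > 0] the event is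
   empty. *)
elim: n m J B => [|n IHn] m J B uJ Jn.
  case: m => [|m].
    rewrite expr0 divr1 mul1e le_measure ?inE//.
      apply: measurableI; last exact: measurable_cylinder.
      exact: measurable_nb_heads_ge.
    exact: measurable_cylinder.
  rewrite (_ : _ `&` _ = set0); last first.
    by apply/seteqP; split=> w //= -[]; rewrite /nb_heads big_nil muln0.
  rewrite measure0 mule_ge0// lee_fin expr0 div1r invr_ge0 exprn_ge0//.
  exact: ltW.
have nJ : n \notin J by apply/negP => /Jn; rewrite ltnn.
have unJ : uniq (n :: J) by rewrite /= nJ.
pose C b := cylinder (n :: J) (fix_coordinate n b B).
pose E k := [set w | (k <= s * nb_heads w n)%N] : set symbol_space.
have mEC k b : measurable (E k `&` C b).
  apply: measurableI; last exact: measurable_cylinder.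
  exact: measurable_nb_heads_ge.
have EC k b : (P (E k `&` C b) <=
    ((p * t ^+ s + (1 - p)) ^+ n / t ^+ k)%:E * P (C b))%E.
  apply: IHn => // i; rewrite in_cons => /orP[/eqP->//|/Jn]; exact: ltnW.
(* A head at coordinate [n] contributes [s], so the earlier tosses need only supply [m - s]; a tail
   contributes nothing. In both cases the last toss is absorbed into the cylinder. *)
have split_last : [set w | (m <= s * nb_heads w n.+1)%N] `&` cylinder J B
    `<=` (E (m - s)%N `&` C true) `|` (E m `&` C false).
  rewrite /C !cylinder_fix_coordinate// => w /= [].
  rewrite nb_headsS; case wn : (w n) => Ew Bw; [left|right]; split=> //.
    by rewrite /E /=; lia.
  by rewrite /E /=; lia.
apply: (@le_trans _ _ (P (E (m - s)%N `&` C true `|` E m `&` C false))).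
  rewrite le_measure ?inE//; last exact: measurableU.
  apply: measurableI; last exact: measurable_cylinder.
  exact: measurable_nb_heads_ge.
apply: (le_trans (measureU2 _ _ _)) => //.
apply: (le_trans (leeD (EC _ _) (EC _ _))).
rewrite /C !probability_fix_coordinate//.
have : P (cylinder J B) \is a fin_num.
  by apply: fin_num_measure; exact: measurable_cylinder.
have : (0 <= P (cylinder J B))%E by [].
case: (P _) => // c; rewrite lee_fin => c0 _.
rewrite -!EFinM -EFinD lee_fin !mulrA -mulrDl ler_wpM2r// exprS.
set A := (_ + _) ^+ n.
have A0 : 0 <= A.
  by rewrite exprn_ge0// addr_ge0 ?subr_ge0// mulr_ge0// exprn_ge0 ?ltW.
(* The subtraction is truncated: if [m < s], the left side is 1 and the claim rests on [1 <= t]. *)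
have tms : (t ^+ (m - s))^-1 <= t ^+ s / t ^+ m.
  rewrite ler_pdivlMr ?exprn_gt0// ler_pdivrMl ?exprn_gt0//.
  by rewrite -exprD ler_weXn2l//; lia.
rewrite [leRHS](_ : _ = A * p * (t ^+ s / t ^+ m) + A / t ^+ m * (1 - p)).
  rewrite lerD2r mulrAC ler_wpM2l// mulr_ge0//.
ring.
Qed.

(** This is the bound that Markov's inequality gives for [t ^+ (s * nb_heads w n)], whose mean is
    [(p * t ^+ s + (1 - p)) ^+ n]; it is the case of an empty list of constraints. *)
Lemma nb_heads_chernoff (s : nat) (t : R) (n m : nat) : 1 <= t ->
  (P [set w | (m <= s * nb_heads w n)%N] <=
   ((p * t ^+ s + (1 - p)) ^+ n / t ^+ m)%:E)%E.
Proof.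
move=> t1; have := @nb_heads_chernoff_cylinder s t n m [::] (fun=> setT) t1.
rewrite (_ : cylinder _ _ = setT); last by apply/seteqP; split.
by rewrite setIT probability_setT mule1; apply.
Qed.

End BernoulliProduct.

(** * Distance of two trajectories and limits of the frequencies *)

Section Contraction.
Context {R : realType} {a b : R} {f g : R -> R} {M c : R} {r : nat}.
Hypotheses (hfI : set_fun `[a, b] `[a, b] f) (hgI : set_fun `[a, b] `[a, b] g).
Hypotheses (hf : M.-lipschitz_(`[a, b]) f) (hg : c.-lipschitz_(`[a, b]) g).
Hypotheses (hM : 1 < M) (hcM : c * M ^+ r <= 1).
Variables (x y : R).
Hypotheses (hx : x \in `[a, b]) (hy : y \in `[a, b]).

Let dist w n := `|trajectory f g w x n - trajectory f g w y n|.

Lemma trajectory_itv w z n : z \in `[a, b] -> trajectory f g w z n \in `[a, b].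
Proof.
by move=> hz; elim: n => //= n IHn; case: (w n); [exact: hfI | exact: hgI].
Qed.

(** The weight [M ^+ (r * n)] avoids negative exponents. In each step it gains [M ^+ r], so a head
    costs at most [M ^+ r.+1] and a tail at most [c * M ^+ r <= 1]. *)
Lemma trajectory_dist_le w n :
  dist w n * M ^+ (r * n) <= M ^+ (r.+1 * nb_heads w n) * (b - a).
Proof.
have M0 : 0 < M by exact: lt_trans hM.
elim: n => [|n].
  rewrite /nb_heads big_nil !muln0 !expr0 mulr1 mul1r /dist /=.
  move: hx hy; rewrite !in_itv /= => /andP[? ?] /andP[? ?].
  by rewrite ler_norml; apply/andP; split; lra.
have Lip : dist w n.+1 <= (if w n then M else c) * dist w n.
  have xn := trajectory_itv w x n hx; have yn := trajectory_itv w y n hy.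
  by rewrite /dist /=; case: (w n); [apply: (hf (_, _)) | apply: (hg (_, _))].
have d0 : 0 <= dist w n by exact: normr_ge0.
rewrite nb_headsS mulnS exprD mulnDr exprD.
have Mr0 : 0 < M ^+ r by rewrite exprn_gt0.
have Mn0 : 0 < M ^+ (r * n) by rewrite exprn_gt0.
set D := dist w n * _; set K := M ^+ (r.+1 * nb_heads w n) => IHn.
have D0 : 0 <= D by rewrite mulr_ge0// ltW.
apply: (@le_trans _ _ ((if w n then M else c) * M ^+ r * D)).
  by rewrite /D mulrACA ler_wpM2r// ltW// mulr_gt0.
case: (w n).
  rewrite muln1 -exprS (mulrC K) -mulrA ler_wpM2l// exprn_ge0// ltW//.
by rewrite muln0 expr0 mulr1; apply: le_trans IHn; rewrite ler_piMl.
Qed.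

Lemma measurable_dist_lt n t :
  measurable ([set w | dist w n < t] : set symbol_space).
Proof.
apply: (measurable_prefix n) => w w' ww' /=.
by rewrite /dist !(eq_trajectory f g w w').
Qed.

Context (p : R) (P : probability symbol_space R).
Hypotheses (hr0 : (0 < r)%N) (hp0 : 0 <= p) (hp1 : p <= 1).
Hypotheses (hp : p < r%:R / (1 + r%:R)) (hP : bernoulli_product p P).

Lemma cvg_dist_lt t : 0 < t ->
  fine (P [set w | dist w n < t]) @[n --> \oo] --> (1 : R).
Proof.
move=> t0; have M0 : 0 < M by exact: lt_trans hM.
have p01 : 0 <= p <= 1 by rewrite hp0.
have [u u1 hu] := negative_drift_tilt p r hr0 p01 hp.
have u0 : 0 < u by exact: lt_trans u1.
(* [M ^+ K] absorbs the ratio of the initial bound [b - a] to the threshold [t], so distance at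
   least [t] forces [r.+1 * nb_heads w n] up to [r * n - K]. *)
have [K hK] := expr_unbounded M ((b - a) / t) hM.
set e := p * u ^+ r.+1 + (1 - p) in hu.
have e0 : 0 <= e.
  by rewrite /e addr_ge0 ?subr_ge0 ?mulr_ge0 ?exprn_ge0 ?(ltW u0).
have eu : `|e / u ^+ r| < 1.
  by rewrite ger0_norm ?divr_ge0 ?exprn_ge0 ?(ltW u0)// ltr_pdivrMr
    ?exprn_gt0// mul1r.
have far_sub n : ~` [set w | dist w n < t] `<=`
    [set w | (r * n - K <= r.+1 * nb_heads w n)%N].
  move=> w /= /negP; rewrite -leNgt => tw.
  rewrite leq_subLR addnC -(@ler_eXn2l _ M)// exprD.
  have := trajectory_dist_le w n.
  move: hK; rewrite ler_pdivrMr// => hK.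
  have A0 : 0 < M ^+ (r * n) by rewrite exprn_gt0.
  have B0 : 0 < M ^+ (r.+1 * nb_heads w n) by rewrite exprn_gt0.
  move=> h; rewrite -(ler_pM2l t0).
  apply: (@le_trans _ _ (dist w n * M ^+ (r * n))).
    by rewrite ler_wpM2r// ltW.
  by apply: (le_trans h); rewrite (mulrC t) -mulrA ler_wpM2l// (ltW B0).
(* Chernoff with [s = r.+1] and [m = r * n - K]. Since [r * n <= K + m] even under truncation,
   dividing by [u ^+ m] costs at most the constant [u ^+ K] over dividing by [u ^+ (r * n)]. *)
have far n : fine (P (~` [set w | dist w n < t])) <= u ^+ K * (e / u ^+ r) ^+ n.
  have mfar := measurableC (measurable_dist_lt n t).
  rewrite -lee_fin fineK; last exact: fin_num_measure.
  have mN := measurable_nb_heads_ge r.+1 n (r * n - K).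
  apply: (@le_trans _ _ (P [set w | (r * n - K <= r.+1 * nb_heads w n)%N])).
    by rewrite le_measure ?inE.
  apply: (le_trans (nb_heads_chernoff p P hp0 hp1 hP r.+1 u n _ (ltW u1))).
  rewrite lee_fin -/e expr_div_n mulrCA -exprM ler_wpM2l ?exprn_ge0//.
  rewrite ler_pdivlMr ?exprn_gt0// ler_pdivrMl ?exprn_gt0//.
  rewrite -exprD ler_weXn2l ?(ltW u1)//.
  by rewrite addnC -leq_subLR.
have near1 n : 1 - u ^+ K * (e / u ^+ r) ^+ n <=
    fine (P [set w | dist w n < t]) <= 1.
  have := far n; rewrite probability_setC; last exact: measurable_dist_lt.
  have := probability_le1 P (measurable_dist_lt n t).
  have : P [set w | dist w n < t] \is a fin_num.
    by apply: fin_num_measure; exact: measurable_dist_lt.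
  by case: (P _) => //= z _; rewrite lee_fin => ? ?; apply/andP; split; lra.
apply: (@squeeze_cvgr _ _ _ _ (fun n => 1 - u ^+ K * (e / u ^+ r) ^+ n)
  (fun=> 1)); [exact: nearW | | exact: cvg_cst].
rewrite -[X in _ --> X]subr0; apply: cvgB; first exact: cvg_cst.
exact: cvg_geometric.
Qed.

Lemma cvg_Fn t : 0 < t -> Fn f g P x y n t @[n --> \oo] --> 1%E.
Proof.
move=> t0; have FnE n : Fn f g P x y n t =
    (n%:R^-1 * series (fun i => fine (P [set w | dist w i < t])) n)%:E.
  rewrite /Fn EFinM /series /= -sumEFin; congr (_ * _)%E.
  apply: eq_bigr => i _; rewrite fineK//.
  by apply: fin_num_measure; exact: measurable_dist_lt.
under eq_fun do rewrite FnE.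
apply: cvg_EFin; first by apply: nearW.
(* Cesaro means are indexed from 0 and average [n.+1] terms, hence the shift. *)
rewrite -cvg_shiftS; exact: (cesaro (cvg_dist_lt t t0)).
Qed.

Lemma Fn_le0 t n : t <= 0 -> Fn f g P x y n t = 0%E.
Proof.
move=> t0; rewrite /Fn big1 ?mule0// => i _.
rewrite (_ : [set _ | _] = set0) ?measure0//.
by apply/seteqP; split=> // w /=; rewrite ltNge (le_trans t0).
Qed.

(** The frequencies have a limit, 0 or 1 according to the sign of [t]. Its finiteness is what allows
    the two extended reals to cancel. *)
Lemma Fup_sub_Flow t : (Fup f g P x y t - Flow f g P x y t = 0)%E.
Proof.
suff [l fl] : exists l : R, Fn f g P x y n t @[n --> \oo] --> l%:E.
  by rewrite /Fup /Flow !(cvg_limn_einf_sup fl) subee.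
have [t0|t0] := leP t 0; last by exists 1; exact: cvg_Fn.
by exists 0; under eq_fun do rewrite Fn_le0//; exact: cvg_cst.
Qed.

End Contraction.

(** * The supremum over pairs of starting points *)

Lemma lipschitz_const_ge0 {R : realType} (a b k : R) (h : R -> R) :
  a < b -> k.-lipschitz_(`[a, b]) h -> 0 <= k.
Proof.
move=> ab hk; have := hk (b, a); rewrite /= !in_itv /= !lexx !(ltW ab).
move=> /(_ (conj isT isT)) hba.
have d0 : 0 < `|b - a| by rewrite normr_gt0 subr_eq0 gt_eqF.
by rewrite -(pmulr_lge0 _ d0); exact: le_trans hba.
Qed.

Theorem theorem4p6 (R : realType) (a b : R) (hab : a < b)
  (f g : R -> R)
  (hfI : set_fun `[a, b] `[a, b] f) (hgI : set_fun `[a, b] `[a, b] g)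
  (M : R) (hf : M.-lipschitz_(`[a, b]) f)
  (c : R) (hc : c < 1) (hg : c.-lipschitz_(`[a, b]) g)
  (hcM : c * M <= 1)
  (r : nat) (hr0 : (0 < r)%N) (hr : c * M ^+ r <= 1)
  (hrmax : forall s : nat, (0 < s)%N -> c * M ^+ s <= 1 -> (s <= r)%N)
  (p : R) (hp0 : 0 <= p) (hp1 : p <= 1) (hp : p < r%:R / (1 + r%:R))
  (P : probability symbol_space R) (hP : bernoulli_product p P) :
  chaos_measure f g P a b = 0%E.
Proof.
have c0 : 0 <= c by exact: lipschitz_const_ge0 hab hg.
have M0 : 0 <= M by exact: lipschitz_const_ge0 hab hf.
(* If [M <= 1], then [c * M ^+ r.+1 <= c < 1], so [r.+1] would also be admissible. *)
have M1 : 1 < M.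
  rewrite ltNge; apply/negP => M1.
  suff : (r.+1 <= r)%N by rewrite ltnn.
  by apply: hrmax => //; apply: (le_trans _ (ltW hc)); rewrite ler_piMr// exprn_ile1.
rewrite /chaos_measure; set S := (X in ereal_sup X).
suff -> : S = [set 0%E] by rewrite ereal_sup1.
apply/seteqP; split=> z /=.
  move=> [x [y [hx hy ->]]]; rewrite integral0_eq ?mule0// => t _.
  exact: (Fup_sub_Flow hfI hgI hf hg M1 hr _ _ hx hy p P hr0 hp0 hp1 hp hP).
(* The value 0 must be attained, since the supremum of the empty set is [-oo]; the pair [(a, a)]
   attains it. *)
have ha : a \in `[a, b] by rewrite in_itv /= lexx ltW.
move=> ->; exists a, a; split=> //; rewrite integral0_eq ?mule0// => t _.
exact: (Fup_sub_Flow hfI hgI hf hg M1 hr _ _ ha ha p P hr0 hp0 hp1 hp hP).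
Qed.
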